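(* Let $G=(V,E)$ be a generically 3-isostatic graph, let $X\subset V$ with $|X|=5$, let $e,f$ be distinct edges in $E(X)$, and let $G'$ be the graph obtained from $G$ by deleting the edges $e$ and $f$ and adding a new vertex adjacent to exactly the five vertices of $X$. Suppose that $|E(X)|\geq 7$. Then either $G-\{e,f\}$ contains an implied $K_4$ whose vertices are in $X$, or $G'$ is generically 3-rigid.
   Context: Graphs are finite, simple and undirected. $E(X)$ is the set of edges of $G$ both of whose endpoints lie in $X$; $G-\{e,f\}$ is $G$ with the edges $e,f$ removed (same vertex set). A (3-dimensional) framework is a pair $(G,\rho)$ with $\rho\in\mathbb R^{3\times|V|}$, where $\rho_i$ denotes the column (point of $\mathbb R^3$) assigned to vertex $i$. An infinitesimal flex of $(G,\rho)$ is $u\in\mathbb R^{3\times |V|}$ with $(u_i-u_j)^T(\rho_i-\rho_j)=0$ for all $ij\in E$. It is trivial if there are a skew symmetric $a\in\mathbb R^{3\times 3}$ and $t\in\mathbb R^3$ with $u_i=t+a\rho_i$ for all $i$. The framework is infinitesimally rigid if every infinitesimal flex is trivial; it is isostatic if it is infinitesimally rigid and deleting any edge of $G$ gives a framework that is not infinitesimally rigid. The configuration $\rho$ is generic if the multiset of its entries is algebraically independent over $\mathbb Q$. $G$ is generically 3-rigid (respectively generically 3-isostatic) if $(G,\rho)$ is infinitesimally rigid (respectively isostatic) for every generic $\rho\in\mathbb R^{3\times|V|}$. For a graph $\Gamma$ and vertices $i,j$ of $\Gamma$, $ij$ is an implied edge of $\Gamma$ (in three dimensions) if every infinitesimal flex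 $u$ of a generic 3-dimensional framework $(\Gamma,\rho)$ satisfies $(u_i-u_j)^T(\rho_i-\rho_j)=0$. (Every edge of $\Gamma$ is an implied edge.) An implied $K_4$ of $\Gamma$ is a set of implied edges of $\Gamma$ forming a complete graph on 4 vertices. *)

(* Defs.v *)
From mathcomp Require Import all_boot all_order all_algebra.
From mathcomp Require Import mpoly.
From mathcomp Require Import reals.

Set Implicit Arguments.
Unset Strict Implicit.
Unset Printing Implicit Defensive.

Import GRing.Theory.
Local Open Scope ring_scope.

(* A graph with vertex type V is given by its edge set, a set of unordered
   pairs. *)
Definition simple_graph (V : finType) (E : {set {set V}}) : Prop :=
  forall e, e \in E -> #|e| = 2%N.

Definition induced_edges (V : finType) (E : {set {set V}}) (X : {set V}) :
  {set {set V}} := [set e in E | e \subset X].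

(* The vertex type of the new graph is [option V]; [None] is the new vertex. *)
Definition add_vertex (V : finType) (E : {set {set V}}) (X : {set V}) :
  {set {set (option V)}} :=
  [set (@Some V) @: e | e : {set V} in E]
    :|: [set [set None; Some x] | x in X].

Section Frameworks.

Variables (R : realType) (V : finType).

Implicit Types (E : {set {set V}}) (rho u : V -> 'cV[R]_3).

Definition inf_flex E rho u : Prop :=
  forall i j, [set i; j] \in E -> (u i - u j)^T *m (rho i - rho j) = 0.

Definition trivial_flex rho u : Prop :=
  exists (a : 'M[R]_3) (t : 'cV[R]_3),
    a^T = - a /\ forall i, u i = t + a *m rho i.

Definition inf_rigid E rho : Prop :=
  forall u, inf_flex E rho u -> trivial_flex rho u.

Definition isostatic E rho : Prop :=
  inf_rigid E rho /\ forall e, e \in E -> ~ inf_rigid (E :\ e) rho.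

(* The variables of the polynomials are indexed by the coordinates (i, c) of
   the configuration, through the enumeration of the finite type V * 'I_3. *)
Definition generic rho : Prop :=
  forall p : {mpoly rat[#|{: V * 'I_3}|]},
    (map_mpoly ratr p).@[fun k => rho (enum_val k).1 (enum_val k).2 0] = 0 ->
    p = 0.

End Frameworks.

Definition generically_rigid (R : realType) (V : finType)
    (E : {set {set V}}) : Prop :=
  forall rho : V -> 'cV[R]_3, generic rho -> inf_rigid E rho.

Definition generically_isostatic (R : realType) (V : finType)
    (E : {set {set V}}) : Prop :=
  forall rho : V -> 'cV[R]_3, generic rho -> isostatic E rho.

Definition implied_edge (R : realType) (V : finType) (E : {set {set V}})
    (i j : V) : Prop :=
  forall rho u : V -> 'cV[R]_3, generic rho -> inf_flex E rho u ->
    (u i - u j)^T *m (rho i - rho j) = 0.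

Definition implied_K4 (R : realType) (V : finType) (E : {set {set V}})
    (K : {set V}) : Prop :=
  #|K| = 4%N /\
  forall i j, i \in K -> j \in K -> i != j -> implied_edge R E i j.

(* Main.v *)
(* Let [S1], [S2] be the strains on the pairs of [X] of the two flexes obtained
   by releasing [e], resp. [f]; every flex of [G - {e, f}] is trivial plus a
   combination of these two. A new vertex at [p = sum m_i rho_i], [sum m_i = 1],
   joined to [X] destroys them all unless some nonzero combination [S] of [S1]
   and [S2] satisfies [l S m = m S m = 0], where [l] is the affine dependence of
   the five points of [X]. Since generic position maximises ranks, if [G'] is
   not rigid then the cubic [(l S1 m)(m S2 m) - (l S2 m)(m S1 m)] vanishes
   identically in [m].

   Put [T i j = l_i l_j (S1 i j, S2 i j)] and let [r i] be the sum of the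
   [T i j] over [j]; write [[u, v]] for the determinant of two vectors of the
   plane. The polarised cubic reads
   [[r i, T j k] + [r j, T i k] + [r k, T i j] = 0]. As [|E(X)| >= 7], at most
   five pairs carry a nonzero [T]. If all [r i] are zero, [T] is balanced at
   every vertex and five edges are too few for two independent such weights; if
   the [r i] are parallel and not all zero, so are all the [T i j], which is
   excluded by [e] and [f]; if [r i] and [r j] are independent, the pairs with
   [T <> 0] form a star, and its four leaves are an implied [K4]. *)
From HB Require Import structures.
Require Import Defs.
From mathcomp Require Import all_boot all_order all_algebra.
From mathcomp Require Import mpoly.
From mathcomp Require Import boolp reals.
From mathcomp Require Import ring lra zify.

Set Implicit Arguments.
Unset Strict Implicit.
Unset Printing Implicit Defensive.

Import Order.TTheory GRing.Theory Num.Theory.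
Local Open Scope ring_scope.

(** * Ranks at algebraically independent points *)

(** With [minor_rank], this turns rank bounds into nonvanishing of minors, which can be compared
    between evaluation points. *)
Lemma rank_minor (F : fieldType) m n (A : 'M[F]_(m, n)) :
  exists f : 'I_(\rank A) -> 'I_m, exists g : 'I_(\rank A) -> 'I_n,
    \det (mxsub f g A) != 0.
Proof.
pose f := maxrankfun A.
have full : row_full (rowsub f A)^T.
  by rewrite /row_full mxrank_tr; apply: maxrowsub_free.
exists f, (fullrankfun full).
rewrite -det_tr -unitfE -[_ \is a _]/(_ \in unitmx) -row_free_unit /row_free.
have -> : (mxsub f (fullrankfun full) A)^T =
    rowsub (fullrankfun full) (rowsub f A)^T.
  by apply/matrixP=> i j; rewrite !mxE.
by rewrite mxrank_fullrowsub.
Qed.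

Lemma minor_rank (F : fieldType) m n r (A : 'M[F]_(m, n)) (f : 'I_r -> 'I_m)
    (g : 'I_r -> 'I_n) : \det (mxsub f g A) != 0 -> (r <= \rank A)%N.
Proof.
rewrite -unitfE -[_ \is a _]/(_ \in unitmx) -row_free_unit => /eqP {1}<-.
have -> : mxsub f g A = rowsub f 1%:M *m A *m colsub g 1%:M.
  by rewrite mul_rowsub_mx mul1mx mulmx_colsub mulmx1;
    apply/matrixP=> i j; rewrite !mxE.
by apply: leq_trans (mxrankM_maxl _ _) _; apply: mxrankM_maxr.
Qed.

(** The evaluation occurring in [generic], named so that it can carry a ring morphism structure and
    commute with determinants. *)
Definition ratr_eval (R : realType) N (x : 'I_N -> R) (p : {mpoly rat[N]}) : R :=
  (map_mpoly ratr p).@[x].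

HB.instance Definition _ (R : realType) N (x : 'I_N -> R) :=
  GRing.RMorphism.copy (ratr_eval x) (meval x \o map_mpoly ratr).

Lemma ratr_evalX (R : realType) N (x : 'I_N -> R) i : ratr_eval x 'X_i = x i.
Proof. by rewrite /ratr_eval map_mpolyX mevalXU. Qed.

Definition alg_independent (R : realType) N (x : 'I_N -> R) :=
  forall p, ratr_eval x p = 0 -> p = 0.

(** A minor that is nonzero at [y] is a nonzero polynomial, so it cannot vanish at [x]. *)
Lemma alg_independent_rank (R : realType) N (x y : 'I_N -> R) m n
    (A : 'M[{mpoly rat[N]}]_(m, n)) : alg_independent x ->
  (\rank (map_mx (ratr_eval y) A) <= \rank (map_mx (ratr_eval x) A))%N.
Proof.
move=> hx; have [f [g]] := rank_minor (map_mx (ratr_eval y) A).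
rewrite -map_mxsub det_map_mx => det0; apply: (@minor_rank _ _ _ _ _ f g).
rewrite -map_mxsub det_map_mx; apply: contraNneq det0 => /hx ->.
by rewrite rmorph0.
Qed.

(** * Homogeneous linear systems with polynomial coefficients *)

Section LinearSystems.

Variables (R : realType) (N : nat) (I J K : finType).
Implicit Types (x y : 'I_N -> R) (A : I -> J -> {mpoly rat[N]}) (u : J -> R).

Definition solves x A u :=
  forall i, \sum_j ratr_eval x (A i j) * u j = 0.

Definition fun_mx x (L : finType) (A : L -> J -> {mpoly rat[N]}) :=
  map_mx (ratr_eval x) (\matrix_(i < #|L|, j < #|J|) A (enum_val i) (enum_val j)).

Definition fun_row u : 'rV[R]_#|J| := \row_j u (enum_val j).

Lemma fun_rowK (v : 'rV[R]_#|J|) : fun_row (fun j => v 0 (enum_rank j)) = v.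
Proof. by apply/rowP=> j; rewrite mxE enum_valK. Qed.

Lemma fun_mx_mulE x (L : finType) (A : L -> J -> {mpoly rat[N]}) u l :
  (fun_row u *m (fun_mx x A)^T) 0 (enum_rank l) =
  \sum_j ratr_eval x (A l j) * u j.
Proof.
rewrite mxE [RHS](reindex (@enum_val J predT)) /=; last first.
  exact/onW_bij/enum_val_bij.
by apply: eq_bigr => j _; rewrite !mxE enum_rankK mulrC.
Qed.

Lemma solvesP x A u :
  reflect (solves x A u) (fun_row u <= kermx (fun_mx x A)^T)%MS.
Proof.
apply: (iffP sub_kermxP) => [uA0 i|Au0].
  by rewrite -fun_mx_mulE uA0 mxE.
by apply/rowP=> i; rewrite -(enum_valK i) fun_mx_mulE Au0 mxE.
Qed.

Lemma span_funP x (B : K -> J -> {mpoly rat[N]}) u :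
  reflect (exists c : K -> R, forall j, u j = \sum_k c k * ratr_eval x (B k j))
    (fun_row u <= fun_mx x B)%MS.
Proof.
have sumE (c : K -> R) j : \sum_k c k * ratr_eval x (B k j) =
    \sum_(k < #|K|) c (enum_val k) * ratr_eval x (B (enum_val k) j).
  by rewrite (reindex (@enum_val K predT)) //; apply/onW_bij/enum_val_bij.
apply: (iffP submxP) => [[c /rowP uE]|[c uE]].
  exists (fun k => c 0 (enum_rank k)) => j; rewrite sumE.
  have := uE (enum_rank j); rewrite !mxE enum_rankK => ->.
  by apply: eq_bigr => k _; rewrite !mxE enum_rankK enum_valK.
exists (\row_k c (enum_val k)); apply/rowP=> j; rewrite !mxE uE sumE.
by apply: eq_bigr => k _; rewrite !mxE.
Qed.

(* At [x] the row space of [B] lies in the kernel of [A]. Genericity of [x]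
   makes both ranks at least those at [y], where they add up to [#|J|], so at
   [x] the row space fills the kernel. *)
Lemma alg_independent_span x y A (B : K -> J -> {mpoly rat[N]}) :
    alg_independent x ->
    (forall k, solves x A (fun j => ratr_eval x (B k j))) ->
    (forall u, solves y A u ->
       exists c : K -> R, forall j, u j = \sum_k c k * ratr_eval y (B k j)) ->
  forall u, solves x A u ->
    exists c : K -> R, forall j, u j = \sum_k c k * ratr_eval x (B k j).
Proof.
move=> hx BA spanAy u Au0; apply/span_funP.
apply: submx_trans (introT (solvesP _ _ _) Au0) _.
have BkerA : (fun_mx x B <= kermx (fun_mx x A)^T)%MS.
  apply/row_subP=> k; have /solvesP := BA (enum_val k).
  by congr (_ <= _)%MS; apply/rowP=> j; rewrite !mxE.
have kerAB : (kermx (fun_mx y A)^T <= fun_mx y B)%MS.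
  apply/rV_subP=> v; rewrite -[v]fun_rowK => /solvesP/spanAy.
  by move=> uB; apply/span_funP.
rewrite -(geq_leqif (mxrank_leqif_sup BkerA)) mxrank_ker mxrank_tr.
apply: leq_trans (leq_sub2l _ (alg_independent_rank y _ hx)) _.
rewrite -/(fun_mx y A) -mxrank_tr -mxrank_ker (leq_trans (mxrankS kerAB)) //.
exact: alg_independent_rank.
Qed.

(** Appending the row [b] to [A] does not raise the rank at [x]. Both ranks are the same at [x] and
    [y], so [b] lies in the row space of [A] at [y] too. *)
Lemma alg_independent_implied x y A (b : J -> {mpoly rat[N]}) :
    alg_independent x -> alg_independent y ->
    (forall u, solves x A u -> \sum_j ratr_eval x (b j) * u j = 0) ->
  forall u, solves y A u -> \sum_j ratr_eval y (b j) * u j = 0.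
Proof.
move=> hx hy implx u /solvesP/sub_kermxP uA0.
pose Ab z := col_mx (fun_mx z A) (fun_mx z (fun _ : unit => b)).
have rankAb z w : alg_independent z -> (\rank (Ab w) <= \rank (Ab z))%N.
  by move=> hz; rewrite /Ab -!map_col_mx; apply: alg_independent_rank.
have sAbA : (Ab x <= fun_mx x A)%MS.
  (* The columns of the cokernel of [A] are solutions at [x], so [b] kills them; this puts [b] in
     the row space. *)
  rewrite col_mx_sub submx_refl submxE /=; apply/eqP/trmx_inj/row_matrixP => j.
  set C := cokermx _; rewrite trmx_mul trmx0 row0 row_mul -[row j _]fun_rowK.
  apply/rowP=> i; rewrite -(enum_valK i) fun_mx_mulE [RHS]mxE.
  apply/implx/solvesP/sub_kermxP; rewrite fun_rowK -row_mul -trmx_mul.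
  by rewrite mulmx_coker trmx0 row0.
have sAAb : (fun_mx y A <= Ab y)%MS by rewrite -addsmxE addsmxSl.
have : (Ab y <= fun_mx y A)%MS.
  rewrite -(geq_leqif (mxrank_leqif_sup sAAb)) (leq_trans (rankAb x y hx)) //.
  by rewrite (leq_trans (mxrankS sAbA)) // alg_independent_rank.
rewrite col_mx_sub => /andP[_ /submxP[D bD]].
have := @fun_mx_mulE y unit (fun _ => b) u tt.
by rewrite bD trmx_mul mulmxA uA0 mul0mx mxE => <-.
Qed.

End LinearSystems.

(** The case of an empty spanning family: a single point [y], however special, certifies a trivial
    kernel at [x]. *)
Lemma alg_independent_kernel (R : realType) N (I J : finType) (x y : 'I_N -> R)
    (A : I -> J -> {mpoly rat[N]}) : alg_independent x ->
    (forall u, solves y A u -> forall j, u j = 0) ->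
  forall u, solves x A u -> forall j, u j = 0.
Proof.
move=> hx ker0 u sol_u j.
pose B (k : void) : J -> {mpoly rat[N]} := match k with end.
have [||c ->] := @alg_independent_span R N I J void x y A B hx _ _ u sol_u.
- by case.
- by move=> v /ker0 v0; exists (fun=> 0) => l; rewrite v0 big1 // => [[]].
by rewrite big1 // => [[]].
Qed.

(** * Strains and trivial motions *)

Section Frameworks.

Variables (R : realType) (V : finType).
Implicit Types (E : {set {set V}}) (A : {set V}) (rho u : V -> 'cV[R]_3).

(** The enumeration is the one in [generic], so [generic rho] is convertible to
    [alg_independent (coords rho)]. *)
Definition coords rho : 'I_#|{: V * 'I_3}| -> R :=
  fun k => rho (enum_val k).1 (enum_val k).2 0.

Definition coord_var (i : V) (c : 'I_3) : {mpoly rat[#|{: V * 'I_3}|]} :=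
  'X_(enum_rank (i, c)).

Lemma eval_coord_var rho i c : ratr_eval (coords rho) (coord_var i c) = rho i c 0.
Proof. by rewrite ratr_evalX /coords enum_rankK. Qed.

Definition strain rho u i j : R := ((u i - u j)^T *m (rho i - rho j)) 0 0.

Lemma strainE rho u i j :
  strain rho u i j = \sum_c (u i c 0 - u j c 0) * (rho i c 0 - rho j c 0).
Proof. by rewrite /strain mxE; apply: eq_bigr => c _; rewrite !mxE. Qed.

Lemma strain_eq0 rho u i j :
  (u i - u j)^T *m (rho i - rho j) = 0 <-> strain rho u i j = 0.
Proof.
split=> [|s0]; first by rewrite /strain => ->; rewrite mxE.
by apply/matrixP=> a b; rewrite !ord1 [RHS]mxE.
Qed.

Lemma inf_flexP E rho u :
  inf_flex E rho u <-> forall i j, [set i; j] \in E -> strain rho u i j = 0.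
Proof. by split=> uE i j /uE ?; apply/strain_eq0. Qed.

Lemma strainC rho u i j : strain rho u i j = strain rho u j i.
Proof. by rewrite !strainE; apply: eq_bigr => c _; ring. Qed.

Lemma strainxx rho u i : strain rho u i i = 0.
Proof. by rewrite strainE big1 // => c _; rewrite !subrr mulr0. Qed.

Lemma skew_dot (a : 'M[R]_3) (d : 'cV[R]_3) :
  a^T = - a -> (a *m d)^T *m d = 0.
Proof.
move=> skew_a; have : ((a *m d)^T *m d)^T = - ((a *m d)^T *m d).
  by rewrite trmx_mul trmxK [in RHS]trmx_mul skew_a mulmxN mulNmx opprK mulmxA.
move=> /matrixP/(_ 0 0); rewrite !mxE => eqN.
by apply/matrixP=> i j; rewrite !ord1 [RHS]mxE mxE; lra.
Qed.

Lemma strain_trivial rho u i j : trivial_flex rho u -> strain rho u i j = 0.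
Proof.
move=> [a [t [skew_a uE]]]; rewrite /strain !uE.
have -> : t + a *m rho i - (t + a *m rho j) = a *m (rho i - rho j).
  by rewrite mulmxBr opprD addrACA subrr add0r.
by rewrite skew_dot // mxE.
Qed.

Lemma strain_comb rho u v a b i j :
  strain rho (fun k => a *: u k + b *: v k) i j =
  a * strain rho u i j + b * strain rho v i j.
Proof.
rewrite !strainE !mulr_sumr -big_split; apply: eq_bigr => c _ /=.
by rewrite !mxE; ring.
Qed.

Definition flatten_motion u (q : V * 'I_3) : R := u q.1 q.2 0.

Definition motion_of (w : V * 'I_3 -> R) : V -> 'cV[R]_3 :=
  fun i => \col_c w (i, c).

(** A row of the rigidity matrix, with entries polynomial in the coordinates of the
    configuration. *)
Definition strain_row (i j : V) (q : V * 'I_3) :=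
  ((q.1 == i)%:R - (q.1 == j)%:R) * (coord_var i q.2 - coord_var j q.2).

Lemma eval_strain_row rho (w : V * 'I_3 -> R) i j :
  \sum_q ratr_eval (coords rho) (strain_row i j q) * w q =
  strain rho (motion_of w) i j.
Proof.
rewrite (eq_bigr (fun q => ratr_eval (coords rho) (strain_row i j (q.1, q.2))
  * w (q.1, q.2))) => [|[] //].
rewrite -(pair_bigA _ (fun k c =>
  ratr_eval (coords rho) (strain_row i j (k, c)) * w (k, c))) exchange_big /=.
rewrite strainE; apply: eq_bigr => c _.
under eq_bigr => k _.
  rewrite /strain_row rmorphM !rmorphB /= !eval_coord_var !rmorph_nat.
  rewrite mulrAC mulrBl; over.
rewrite -mulr_suml sumrB !mxE; congr (_ * _).
have pick l : \sum_k (k == l)%:R * w (k, c) = w (l, c).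
  by rewrite (bigD1 l) //= eqxx mul1r big1 ?addr0 // => k /negPf->; rewrite mul0r.
by rewrite !pick.
Qed.

(** Rows are indexed by all ordered pairs; a pair that is not an edge contributes a zero row. *)
Definition flex_system E (p : V * V) q :=
  if [set p.1; p.2] \in E then strain_row p.1 p.2 q else 0.

Lemma flex_systemP E rho w :
  solves (coords rho) (flex_system E) w <-> inf_flex E rho (motion_of w).
Proof.
rewrite inf_flexP; split=> [sol i j ijE|flex [i j]].
  by have := sol (i, j); rewrite /flex_system /= ijE eval_strain_row.
rewrite /flex_system /=; case: (boolP ([set i; j] \in E)) => [ijE|_].
  by rewrite eval_strain_row flex.
by rewrite big1 // => q _; rewrite rmorph0 mul0r.
Qed.

(** One generic configuration decides for all of them, since the strain of [i j] is a linear form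
    with polynomial coefficients. *)
Lemma implied_edge_generic E rho i j : generic rho ->
  (forall u, inf_flex E rho u -> strain rho u i j = 0) -> implied_edge R E i j.
Proof.
move=> gen_rho impl rho' u gen_rho' flex_u; apply/strain_eq0.
have impl' := @alg_independent_implied R _ _ _ (coords rho) (coords rho')
  (flex_system E) (strain_row i j) gen_rho gen_rho'.
have := impl' _ (flatten_motion u); rewrite eval_strain_row.
have -> : strain rho' (motion_of (flatten_motion u)) i j = strain rho' u i j.
  by rewrite !strainE; apply: eq_bigr => c _; rewrite !mxE.
apply.
  by move=> w /flex_systemP/impl; rewrite eval_strain_row.
apply/flex_systemP/inf_flexP=> k l /(flex_u k l)/strain_eq0 <-.
by rewrite !strainE; apply: eq_bigr => c _; rewrite !mxE.
Qed.

(** Translations along the axes and rotations in the coordinate planes. The rotations are listed for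
    all ordered pairs of axes; the redundancy is harmless, as only their span matters. *)
Definition trivial_system (k : 'I_3 + 'I_3 * 'I_3) (q : V * 'I_3) :=
  match k with
  | inl c => (q.2 == c)%:R
  | inr (b, d) =>
      (q.2 == b)%:R * coord_var q.1 d - (q.2 == d)%:R * coord_var q.1 b
  end.

Lemma trivial_systemP rho w :
  (exists c, forall q,
     w q = \sum_k c k * ratr_eval (coords rho) (trivial_system k q)) <->
  trivial_flex rho (motion_of w).
Proof.
have sumE c i e :
    \sum_k c k * ratr_eval (coords rho) (trivial_system k (i, e)) =
    c (inl e) + \sum_d (c (inr (e, d)) - c (inr (d, e))) * rho i d 0.
  rewrite big_sumType /=; congr (_ + _).
    rewrite (bigD1 e) //= eqxx rmorph1 mulr1 big1 ?addr0 // => d /negPf nde.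
    by rewrite /= [e == d]eq_sym nde rmorph0 mulr0.
  under [RHS]eq_bigr do rewrite mulrBl; rewrite sumrB.
  transitivity (\sum_b \sum_d (c (inr (b, d)) * ((e == b)%:R * rho i d 0)
                     - c (inr (b, d)) * ((e == d)%:R * rho i b 0))).
    rewrite pair_bigA; apply: eq_bigr => -[b d] _ /=.
    by rewrite rmorphB !rmorphM /= !rmorph_nat !eval_coord_var mulrBr.
  under eq_bigr do rewrite sumrB; rewrite sumrB; congr (_ - _).
    rewrite (bigD1 e) //= [X in _ + X]big1 ?addr0 => [|b /negPf nbe]; last first.
      by rewrite big1 // => d _; rewrite [e == b]eq_sym nbe mul0r mulr0.
    by apply: eq_bigr => d _; rewrite eqxx mul1r.
  apply: eq_bigr => b _; rewrite (bigD1 e) //= eqxx mul1r big1 ?addr0 // => d.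
  by move=> /negPf nde; rewrite [e == d]eq_sym nde mul0r mulr0.
split=> [[c wE]|[a [t [skew_a wE]]]].
  exists (\matrix_(b, d) (c (inr (b, d)) - c (inr (d, b)))), (\col_e c (inl e)).
  split=> [|i]; first by apply/matrixP=> b d; rewrite !mxE opprB.
  apply/colP=> e; rewrite !mxE wE sumE; congr (_ + _).
  by apply: eq_bigr => d _; rewrite mxE.
(* Each plane is listed twice with opposite signs, hence the factor one half. *)
exists (fun k => match k with inl e => t e 0 | inr (b, d) => a b d / 2 end).
move=> [i e]; rewrite sumE; have /colP/(_ e) := wE i; rewrite !mxE => ->.
congr (_ + _); apply: eq_bigr => d _; congr (_ * _).
by have /matrixP/(_ e d) := skew_a; rewrite !mxE => ->; field.
Qed.

Lemma trivial_flex_flex E rho u : trivial_flex rho u -> inf_flex E rho u.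
Proof. by move=> triv; apply/inf_flexP=> i j _; apply: strain_trivial. Qed.

(** Trivial motions are flexes at every configuration and exhaust them at [rho0], so
    [alg_independent_span] applies. This permits testing rigidity at a special position. *)
Lemma inf_rigid_generic E rho rho0 :
  generic rho -> inf_rigid E rho0 -> inf_rigid E rho.
Proof.
move=> gen_rho rigid0 u flex_u.
have eta v : trivial_flex rho (motion_of (flatten_motion v)) -> trivial_flex rho v.
  move=> [a [t [skew_a vE]]]; exists a, t; split=> // i; rewrite -vE.
  by apply/colP=> c; rewrite mxE.
apply/eta/trivial_systemP.
apply: (@alg_independent_span R _ _ _ _ _ (coords rho0) (flex_system E)) => //.
- move=> k; apply/flex_systemP/trivial_flex_flex/trivial_systemP.
  exists (fun l => (l == k)%:R) => q; rewrite (bigD1 k) //= eqxx mul1r.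
  by rewrite big1 ?addr0 // => l /negPf->; rewrite mul0r.
- by move=> w /flex_systemP/rigid0/trivial_systemP.
apply/flex_systemP/inf_flexP=> k l /(flex_u k l)/strain_eq0 <-.
by rewrite !strainE; apply: eq_bigr => c _; rewrite !mxE.
Qed.

(* The points of [A] are sent to the vertices [0], [e_0], [e_1], [e_2] of the
   standard simplex, in the order of [enum A]. *)
Definition simplex_config A : V -> 'cV[R]_3 :=
  fun i => \col_c (index i (enum A) == c.+1)%:R.

Lemma index_enum_inj A : {in A &, injective (index^~ (enum A))}.
Proof. by move=> i j iA jA; apply: (index_inj i); rewrite mem_enum. Qed.

(** It suffices to look at the simplex configuration: there the coordinate equations kill every
    coefficient except the one at the origin, and the sum kills that one. *)
Lemma generic_affine_free A rho (l : V -> R) : generic rho -> (#|A| <= 4)%N ->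
  (forall i, i \notin A -> l i = 0) -> \sum_i l i = 0 ->
  \sum_i l i *: rho i = 0 -> forall i, l i = 0.
Proof.
move=> gen_rho cardA l0 suml sumlr.
pose sys (k : V + option 'I_3) (j : V) : {mpoly rat[#|{: V * 'I_3}|]} :=
  match k with
  | inl i => ((i == j) && (i \notin A))%:R
  | inr None => 1
  | inr (Some c) => coord_var j c
  end.
have sysP rho' m : solves (coords rho') sys m <->
    [/\ forall i, i \notin A -> m i = 0, \sum_i m i = 0
      & forall c, \sum_i rho' i c 0 * m i = 0].
  have rowl i : \sum_j ratr_eval (coords rho') (sys (inl i) j) * m j =
      (i \notin A)%:R * m i.
    rewrite (bigD1 i) //= eqxx rmorph_nat big1 ?addr0 // => j.
    by rewrite eq_sym => /negPf->; rewrite rmorph0 mul0r.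
  have rown : \sum_j ratr_eval (coords rho') (sys (inr None) j) * m j =
      \sum_j m j by apply: eq_bigr => j _; rewrite rmorph1 mul1r.
  have rowc c : \sum_j ratr_eval (coords rho') (sys (inr (Some c)) j) * m j =
      \sum_j rho' j c 0 * m j by apply: eq_bigr => j _; rewrite eval_coord_var.
  split=> [sol|[m0 summ sumc] [i|[c|]]].
  - split=> [i iA||c]; [|by rewrite -rown|by rewrite -rowc].
    by have := sol (inl i); rewrite rowl iA mul1r.
  - by rewrite rowl; case: (boolP (i \in A)) => [_|/m0 ->]; rewrite ?mul0r ?mulr0.
  - by rewrite rowc.
  - by rewrite rown.
apply: (@alg_independent_kernel _ _ _ _ _ (coords (simplex_config A)) sys gen_rho).
  move=> m /sysP[m0 summ sumc].
  have m_pos i : i \in A -> (0 < index i (enum A))%N -> m i = 0.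
    move=> iA pos_i; have lt3 : ((index i (enum A)).-1 < 3)%N.
      rewrite -ltnS prednK // (leq_trans _ cardA) // cardE.
      by rewrite index_mem mem_enum.
    rewrite -(sumc (Ordinal lt3)) (bigD1 i) //= mxE /= prednK // eqxx mul1r.
    rewrite big1 ?addr0 // => j ji; case: (boolP (j \in A)) => [jA|/m0->].
      rewrite mxE /= prednK //; case: eqP => [/index_enum_inj|]; last by rewrite mul0r.
      by move=> /(_ jA iA) eij; rewrite eij eqxx in ji.
    by rewrite mulr0.
  move=> i; case: (boolP (i \in A)) => [iA|/m0 //].
  have [idx0|/(m_pos _ iA) //] := posnP (index i (enum A)).
  move: summ; rewrite (bigD1 i) //= big1 ?addr0 // => j ji.
  case: (boolP (j \in A)) => [jA|/m0 //]; apply: m_pos => //.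
  by rewrite lt0n -idx0; apply: contra_neq ji => /index_enum_inj->.
apply/sysP; split=> // c; move/colP/(_ c): sumlr; rewrite mxE summxE => sumc.
by rewrite -[RHS]sumc; apply: eq_bigr => i _; rewrite mxE mulrC.
Qed.

(** An affine function vanishing at the vertices of a simplex is zero. The unknowns are its constant
    term and its three slopes. *)
Lemma generic_affine_span A rho (z : 'cV[R]_3) (d : R) : generic rho ->
  #|A| = 4%N -> (forall i, i \in A -> (z^T *m rho i) 0 0 = d) -> z = 0.
Proof.
move=> gen_rho cardA zA.
pose sys (i : V) (k : unit + 'I_3) : {mpoly rat[#|{: V * 'I_3}|]} :=
  (i \in A)%:R * (if k is inr c then coord_var i c else 1).
have sysP rho' m : solves (coords rho') sys m <->
    forall i, i \in A -> m (inl tt) + \sum_c rho' i c 0 * m (inr c) = 0.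
  have rowi i : \sum_k ratr_eval (coords rho') (sys i k) * m k =
      (i \in A)%:R * (m (inl tt) + \sum_c rho' i c 0 * m (inr c)).
    rewrite big_sumType /= (big_pred1 tt) => [|[] //].
    rewrite mulrDr mulr_sumr rmorphM rmorph_nat rmorph1 mulr1.
    congr (_ + _); apply: eq_bigr => c _.
    by rewrite rmorphM rmorph_nat /= eval_coord_var mulrA.
  split=> [sol i iA|m0 i]; first by have := sol i; rewrite rowi iA mul1r.
  by rewrite rowi; case: (boolP (i \in A)) => [/m0 ->|_]; rewrite ?mulr0 ?mul0r.
have zero m : solves (coords (simplex_config A)) sys m -> forall k, m k = 0.
  move=> /sysP m0.
  have nthA k : (k < 4)%N -> exists2 i, i \in A & index i (enum A) = k.
    move=> ltk; have /card_gt0P[i0 _] : (0 < #|A|)%N by rewrite cardA.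
    exists (nth i0 (enum A) k); first by rewrite -mem_enum mem_nth // -cardE cardA.
    by rewrite index_uniq ?enum_uniq // -cardE cardA.
  have mN : m (inl tt) = 0.
    have [i iA idx] := nthA 0%N isT; have := m0 i iA; rewrite big1 ?addr0 // => c _.
    by rewrite mxE idx mul0r.
  case=> [[] //|c]; have [i iA idx] := nthA c.+1 (ltn_ord c).
  have := m0 i iA; rewrite mN add0r (bigD1 c) //= mxE idx eqxx mul1r big1 ?addr0 //.
  by move=> b /negPf nbc; rewrite mxE idx eqSS val_eqE eq_sym nbc mul0r.
pose m (k : unit + 'I_3) := if k is inr c then z c 0 else - d.
have sol_m : solves (coords rho) sys m.
  apply/sysP=> i /zA zi; rewrite /m -zi mxE addrC; apply/eqP; rewrite subr_eq0.
  by apply/eqP/eq_bigr => c _; rewrite mxE mulrC.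
apply/colP=> c; rewrite mxE.
exact: (alg_independent_kernel (A := sys) gen_rho zero sol_m (inr c)).
Qed.

End Frameworks.

(** A polynomial relation between the old points becomes one between all points after renaming
    variables by [inc]. Its left inverse [proj] recovers [p]; the value 0 at the new vertex is
    arbitrary. *)
Lemma generic_comp_Some (R : realType) (V : finType)
    (rho : option V -> 'cV[R]_3) : generic rho -> generic (rho \o Some).
Proof.
move=> gen_rho p p0.
pose inc := [tuple coord_var (Some (enum_val k).1) (enum_val k).2
            | k < #|{: V * 'I_3}|].
pose proj := [tuple (if (enum_val k).1 is Some i
                     then coord_var i (enum_val k).2 else 0)
             | k < #|{: option V * 'I_3}|].
have incK : (p \mPo inc) \mPo proj = p.
  rewrite [in RHS](mpolyE p) [p \mPo inc]comp_mpolyEX raddf_sum; apply: eq_bigr => m _ /=.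
  rewrite comp_mpolyZ comp_mpolyX rmorph_prod mpolyXE_id; congr (_ *: _).
  apply: eq_bigr => k _; rewrite rmorphXn /= tnth_mktuple comp_mpolyXU -tnth_nth.
  by rewrite tnth_mktuple enum_rankK /= /coord_var -surjective_pairing enum_valK.
rewrite -incK [p \mPo inc]gen_rho ?comp_mpoly0 //.
rewrite map_mpoly_comp; last exact: fmorph_inj.
rewrite comp_mpoly_meval -[RHS]p0; apply: meval_eq => k.
rewrite tnth_map tnth_mktuple map_mpolyX mevalXU enum_rankK.
by [].
Qed.

(** * Plane-valued weights on the pairs of five points *)

(* Two balanced weights, one nonzero at [ab] and zero at the second marked edge
   and the other the opposite way, cannot both live on five edges: for each
   choice of the other three edges, linear arithmetic kills one of them. *)
Lemma balanced_adjacent (R : realFieldType) (ab ac ad ag bc bd bg cd cg dg : R * R) :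
  ab + ac + ad + ag = 0 -> ab + bc + bd + bg = 0 -> ac + bc + cd + cg = 0 ->
  ad + bd + cd + dg = 0 -> ag + bg + cg + dg = 0 ->
  ab.1 != 0 -> ab.2 = 0 -> ac.1 = 0 -> ac.2 != 0 ->
  ((ab != 0%R) + (ac != 0%R) + (ad != 0%R) + (ag != 0%R) + (bc != 0%R) +
   (bd != 0%R) + (bg != 0%R) + (cd != 0%R) + (cg != 0%R) + (dg != 0%R) <= 5)%N ->
  False.
Proof.
case: ab ac ad ag bc bd bg cd cg dg
  => [ab1 ab2] [ac1 ac2] [ad1 ad2] [ag1 ag2] [bc1 bc2] [bd1 bd2] [bg1 bg2]
     [cd1 cd2] [cg1 cg2] [dg1 dg2].
move=> [ea1 ea2] [eb1 eb2] [ec1 ec2] [ed1 ed2] [eg1 eg2] /=.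
move=> ab0 ab20 ac10 ac0; subst ab2 ac1.
have -> : ((ab1, 0) != 0 :> R * R) by apply: contra_neq ab0 => -[].
have -> : ((0, ac2) != 0 :> R * R) by apply: contra_neq ac0 => -[].
case: ((ad1, ad2) =P 0) => [[? ?]|_] //=; try subst ad1 ad2;
case: ((ag1, ag2) =P 0) => [[? ?]|_] //=; try subst ag1 ag2;
case: ((bc1, bc2) =P 0) => [[? ?]|_] //=; try subst bc1 bc2;
case: ((bd1, bd2) =P 0) => [[? ?]|_] //=; try subst bd1 bd2;
case: ((bg1, bg2) =P 0) => [[? ?]|_] //=; try subst bg1 bg2;
case: ((cd1, cd2) =P 0) => [[? ?]|_] //=; try subst cd1 cd2;
case: ((cg1, cg2) =P 0) => [[? ?]|_] //=; try subst cg1 cg2;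
case: ((dg1, dg2) =P 0) => [[? ?]|_] //=; try subst dg1 dg2;
  move=> _; first [move/eqP: ab0; apply; lra | move/eqP: ac0; apply; lra].
Qed.

(** The companion case, where the two marked edges have no common vertex. The other eight pairs are
    split into zero and nonzero; the count discards the patterns with too many edges. *)
Lemma balanced_disjoint (R : realFieldType) (ab ac ad ag bc bd bg cd cg dg : R * R) :
  ab + ac + ad + ag = 0 -> ab + bc + bd + bg = 0 -> ac + bc + cd + cg = 0 ->
  ad + bd + cd + dg = 0 -> ag + bg + cg + dg = 0 ->
  ab.1 != 0 -> ab.2 = 0 -> cd.1 = 0 -> cd.2 != 0 ->
  ((ab != 0%R) + (ac != 0%R) + (ad != 0%R) + (ag != 0%R) + (bc != 0%R) +
   (bd != 0%R) + (bg != 0%R) + (cd != 0%R) + (cg != 0%R) + (dg != 0%R) <= 5)%N ->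
  False.
Proof.
case: ab ac ad ag bc bd bg cd cg dg
  => [ab1 ab2] [ac1 ac2] [ad1 ad2] [ag1 ag2] [bc1 bc2] [bd1 bd2] [bg1 bg2]
     [cd1 cd2] [cg1 cg2] [dg1 dg2].
move=> [ea1 ea2] [eb1 eb2] [ec1 ec2] [ed1 ed2] [eg1 eg2] /=.
move=> ab0 ab20 cd10 cd0; subst ab2 cd1.
have -> : ((ab1, 0) != 0 :> R * R) by apply: contra_neq ab0 => -[].
have -> : ((0, cd2) != 0 :> R * R) by apply: contra_neq cd0 => -[].
case: ((ac1, ac2) =P 0) => [[? ?]|_] //=; try subst ac1 ac2;
case: ((ad1, ad2) =P 0) => [[? ?]|_] //=; try subst ad1 ad2;
case: ((ag1, ag2) =P 0) => [[? ?]|_] //=; try subst ag1 ag2;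
case: ((bc1, bc2) =P 0) => [[? ?]|_] //=; try subst bc1 bc2;
case: ((bd1, bd2) =P 0) => [[? ?]|_] //=; try subst bd1 bd2;
case: ((bg1, bg2) =P 0) => [[? ?]|_] //=; try subst bg1 bg2;
case: ((cg1, cg2) =P 0) => [[? ?]|_] //=; try subst cg1 cg2;
case: ((dg1, dg2) =P 0) => [[? ?]|_] //=; try subst dg1 dg2;
  move=> _; first [move/eqP: ab0; apply; lra | move/eqP: cd0; apply; lra].
Qed.

Section FivePoints.

Variables (R : realFieldType) (V : finType) (X : {set V}).

Definition bracket (u v : R * R) : R := u.1 * v.2 - u.2 * v.1.

Lemma pairP (u v : R * R) : u.1 = v.1 -> u.2 = v.2 -> u = v.
Proof. by case: u v => [? ?] [? ?] /= -> ->. Qed.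

Lemma bracket_indep (u v w : R * R) : bracket u v != 0 ->
  bracket u w = 0 -> bracket v w = 0 -> w = 0.
Proof.
rewrite /bracket => uv uw vw; apply: pairP => /=; apply: (mulfI uv); rewrite mulr0.
  transitivity (v.1 * (u.1 * w.2 - u.2 * w.1) - u.1 * (v.1 * w.2 - v.2 * w.1)).
    by ring.
  by rewrite uw vw !mulr0 subrr.
transitivity (v.2 * (u.1 * w.2 - u.2 * w.1) - u.2 * (v.1 * w.2 - v.2 * w.1)).
  by ring.
by rewrite uw vw !mulr0 subrr.
Qed.

Lemma bracket_trans (u v w : R * R) : w != 0 ->
  bracket u w = 0 -> bracket v w = 0 -> bracket u v = 0.
Proof.
by move=> w0 uw vw; apply: contraNeq w0 => uv; apply/eqP/(bracket_indep uv).
Qed.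

Lemma bracketN (u v : R * R) : bracket u (- v) = - bracket u v.
Proof. by rewrite /bracket /=; ring. Qed.

Lemma bracketv0 (u : R * R) : bracket u 0 = 0.
Proof. by rewrite /bracket /= !mulr0 subrr. Qed.

Lemma bracketvv (u : R * R) : bracket u u = 0.
Proof. by rewrite /bracket; ring. Qed.

(** Used to name the remaining points of [X], so that sums over [X] unfold into five explicit
    terms. *)
Lemma seq_completion (s : seq V) : uniq s -> {subset s <= X} ->
  exists2 s', uniq (s ++ s') & s ++ s' =i X.
Proof.
move=> uniq_s sX; exists (enum (X :\: [set x in s])).
  rewrite cat_uniq uniq_s enum_uniq andbT; apply/hasPn=> x.
  by rewrite mem_enum !inE => /andP[].
by move=> x; rewrite mem_cat mem_enum !inE; case: (boolP (x \in s)) => // /sX ->.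
Qed.

Hypothesis cardX : #|X| = 5%N.

Lemma completion_size s : uniq s -> s =i X -> size s = 5%N.
Proof. by move=> uniq_s /eq_card; rewrite cardX; move/card_uniqP: uniq_s => ->. Qed.

Variable T : V -> V -> R * R.
Hypotheses (Tsym : forall i j, T i j = T j i) (Tdiag : forall i, T i i = 0).
Hypothesis Toff : forall i j, j \notin X -> T i j = 0.

Let r i := \sum_j T i j.

Hypothesis polar : {in X & &, forall i j k,
  bracket (r i) (T j k) + bracket (r j) (T i k) + bracket (r k) (T i j) = 0}.
Hypothesis few : (\sum_(i in X) \sum_(j in X) (T i j != 0%R) <= 10)%N.

Lemma sum5 s i : uniq s -> s =i X -> r i = \sum_(j <- s) T i j.
Proof.
move=> uniq_s sX; rewrite big_uniq // (eq_bigl _ _ sX) /r.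
rewrite (bigID (mem X)) /= [X in _ + X]big1 ?addr0 // => j; exact: Toff.
Qed.

(** [few] counts ordered pairs, so its bound is halved here. *)
Lemma count5 a b c d g : let s := [:: a; b; c; d; g] in uniq s -> s =i X ->
  ((T a b != 0%R) + (T a c != 0%R) + (T a d != 0%R) + (T a g != 0%R) + (T b c != 0%R)
   + (T b d != 0%R) + (T b g != 0%R) + (T c d != 0%R) + (T c g != 0%R) + (T d g != 0%R)
   <= 5)%N.
Proof.
move=> s uniq_s sX; have := few; rewrite -(eq_bigl _ _ sX) -big_uniq //=.
under eq_bigr => i _ do rewrite -(eq_bigl _ _ sX) -big_uniq //=.
rewrite unlock /= !Tdiag eqxx /= !(Tsym b a, Tsym c a, Tsym d a, Tsym g a,
  Tsym c b, Tsym d b, Tsym g b, Tsym d c, Tsym g c, Tsym g d).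
do 10![move: (nat_of_bool _) => ?]; lia.
Qed.

(** Taking [i] twice in [polar] gives twice this bracket, the diagonal weight being zero. So [T i j]
    is parallel to [r i], and by symmetry to [r j]. *)
Lemma polar2 : {in X &, forall i j, bracket (r i) (T i j) = 0}.
Proof.
move=> i j iX jX; have := polar iX iX jX; rewrite Tdiag /bracket /=; lra.
Qed.

(** * Two points with linearly independent row sums *)

Section Nondegenerate.

Variables (i j : V).
Hypotheses (iX : i \in X) (jX : j \in X) (rij : bracket (r i) (r j) != 0).

Lemma nondegenerate_base : T i j = 0.
Proof.
by apply: (bracket_indep rij); [exact: polar2 | rewrite Tsym; exact: polar2].
Qed.

(** As [T i j] is zero, [polar] at [i], [j], [x] makes one of the two weights parallel to both [r i]
    and [r j] once the other vanishes. *)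
Lemma nondegenerate_zero x : x \in X -> (T i x == 0) = (T j x == 0).
Proof.
move=> xX; have := polar iX jX xX; rewrite nondegenerate_base.
have := polar2 iX xX; have := polar2 jX xX => rj ri p.
apply/eqP/eqP => T0.
  apply: (bracket_indep rij) => //; move: p; rewrite T0 /bracket /=; lra.
apply: (bracket_indep rij) => //; move: p; rewrite T0 /bracket /=; lra.
Qed.

(** The nonzero weight [T i x] is parallel to both [r i] and [r x], and [T j x] to both [r j] and
    [r x]; hence [r x] is parallel to two independent vectors. *)
Lemma nondegenerate_r x : x \in X -> T i x != 0 -> r x = 0.
Proof.
move=> xX Tix; have Tjx : T j x != 0 by rewrite -nondegenerate_zero.
apply: (bracket_indep rij).
  by apply: (bracket_trans Tix); [|rewrite Tsym]; apply: polar2.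
by apply: (bracket_trans Tjx); [|rewrite Tsym]; apply: polar2.
Qed.

Lemma nondegenerate_edge x y : x \in X -> y \in X ->
  bracket (r x) (T i y) = 0 -> bracket (r y) (T i x) = 0 ->
  bracket (r x) (T j y) = 0 -> bracket (r y) (T j x) = 0 -> T x y = 0.
Proof.
move=> xX yX ixy iyx jxy jyx; apply: (bracket_indep rij).
  by have := polar iX xX yX; rewrite ixy iyx; lra.
by have := polar jX xX yX; rewrite jxy jyx; lra.
Qed.

(** Opposite weights would be parallel to both [r i] and [r j]. *)
Lemma nondegenerate_sum x : x \in X -> T i x != 0 -> T i x + T j x != 0.
Proof.
move=> xX Tix; apply: contraNneq (Tix) => /eqP; rewrite addr_eq0 => /eqP Tij.
apply/eqP/(bracket_indep rij); first exact: polar2.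
by rewrite Tij bracketN polar2 // oppr0.
Qed.

Lemma nondegenerate_neq x : T i x != 0 -> (i != x) && (j != x).
Proof.
by move=> Tix; apply/andP; split; apply: contra_neq Tix => <-;
  rewrite ?Tdiag ?nondegenerate_base.
Qed.

Lemma nondegenerate_neq_base : i != j.
Proof. by apply: contra_neq rij => ->; rewrite bracketvv. Qed.

(** With two such points and [n] the fifth one, [r x] and [r y] vanish, hence so does [T x y].
    Balance at [x] and at [y] then makes [T x n] and [T y n] nonzero. With the four weights from [i]
    and [j] to [x] and [y], this is six edges. *)
Lemma nondegenerate_unique x y : x \in X -> y \in X -> T i x != 0 -> T i y != 0 ->
  x = y.
Proof.
move=> xX yX Tix Tiy; apply/eqP/negPn/negP => xy.
have [/andP[ix jx] /andP[iy jy]] := (nondegenerate_neq Tix, nondegenerate_neq Tiy).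
have [||s uniq_s sX] := @seq_completion [:: i; j; x; y].
- by rewrite /= !inE !negb_or nondegenerate_neq_base ix iy jx jy xy.
- by move=> z; rewrite !inE => /or4P[] /eqP->.
have := completion_size uniq_s sX.
case: s uniq_s sX => [|n [|]] // uniq_s sX _.
have nX : n \in X by rewrite -sX !inE eqxx !orbT.
have [rx ry] := (nondegenerate_r xX Tix, nondegenerate_r yX Tiy).
have Txy : T x y = 0.
  by apply: nondegenerate_edge => //; rewrite ?rx ?ry /bracket /=; ring.
have endpoint z : z \in X -> T i z != 0 -> r z = 0 ->
    r z = T i z + T j z + T z n -> T z n != 0.
  move=> zX Tiz -> /esym/eqP; rewrite addr_eq0 => /eqP sumN.
  by have := nondegenerate_sum zX Tiz; rewrite sumN oppr_eq0.
have Txn : T x n != 0.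
  apply: endpoint => //; rewrite (sum5 _ uniq_s sX) unlock /= Tdiag Txy (Tsym x i).
  by rewrite (Tsym x j) addr0 !add0r addrA.
have Tyn : T y n != 0.
  apply: endpoint => //; rewrite (sum5 _ uniq_s sX) unlock /= Tdiag (Tsym y x) Txy.
  by rewrite (Tsym y i) (Tsym y j) addr0 !add0r addrA.
have := count5 uniq_s sX; rewrite Tix Tiy Txn Tyn -!nondegenerate_zero // Tix Tiy /=.
by rewrite !(addn1, addSn) !ltnS ltn0.
Qed.

(** Since [r i] is nonzero, [i] has a neighbour [k]; it is the only one, and the only one of [j].
    Away from [k] all weights to [i] and [j] vanish, and [nondegenerate_edge] applies. *)
Lemma nondegenerate_star :
  exists2 k, k \in X & {in X &, forall x y, x != k -> y != k -> T x y = 0}.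
Proof.
have [k kX Tik] : exists2 k, k \in X & T i k != 0.
  apply/exists_inP; rewrite -negb_forall_in; apply/negP => /forall_inP T0.
  suff r0 : r i = 0.
    by have := rij; rewrite r0 /bracket /= !mul0r subrr eqxx.
  rewrite /r big1 // => x _; case: (boolP (x \in X)) => [/T0/eqP //|].
  exact: Toff.
exists k => //.
have Ti x : x \in X -> x != k -> T i x = 0.
  by move=> xX; apply: contra_neq_eq => Tix; apply: nondegenerate_unique.
have Tj x : x \in X -> x != k -> T j x = 0.
  by move=> xX xk; apply/eqP; rewrite -nondegenerate_zero // Ti ?eqxx.
move=> x y xX yX xk yk.
by apply: nondegenerate_edge => //; rewrite ?Ti ?Tj // bracketv0.
Qed.

End Nondegenerate.

Lemma row5 s i : uniq s -> s =i X -> r i = 0 -> \sum_(j <- s) T i j = 0.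
Proof. by move=> uniq_s sX; rewrite (sum5 i uniq_s sX). Qed.

(** The pairs [ab] and [cd] are distinct, so they share one vertex or none; the first case is
    brought to a common form by swapping endpoints. *)
Lemma balanced_few_edges a b c d : {in X, forall i, r i = 0} ->
  a \in X -> b \in X -> c \in X -> d \in X -> (T a b).1 != 0 -> (T a b).2 = 0 ->
  (T c d).1 = 0 -> (T c d).2 != 0 -> False.
Proof.
move=> r0.
have listed x1 x2 x3 x4 x5 : let s := [:: x1; x2; x3; x4; x5] in
    uniq s -> s =i X -> [/\ T x1 x2 + T x1 x3 + T x1 x4 + T x1 x5 = 0,
      T x1 x2 + T x2 x3 + T x2 x4 + T x2 x5 = 0,
      T x1 x3 + T x2 x3 + T x3 x4 + T x3 x5 = 0,
      T x1 x4 + T x2 x4 + T x3 x4 + T x4 x5 = 0 &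
      T x1 x5 + T x2 x5 + T x3 x5 + T x4 x5 = 0].
  move=> s uniq_s sX; have row x : x \in X -> \sum_(j <- s) T x j = 0.
    by move=> xX; apply: row5 => //; apply: r0.
  split; [have := row x1|have := row x2|have := row x3|have := row x4|have := row x5];
  rewrite -sX !inE eqxx ?orbT /s unlock /= Tdiag !addrA ?addr0 ?add0r => /(_ isT) <- //.
  - by rewrite (Tsym x2 x1).
  - by rewrite (Tsym x3 x1) (Tsym x3 x2).
  - by rewrite (Tsym x4 x1) (Tsym x4 x2) (Tsym x4 x3).
  - by rewrite (Tsym x5 x1) (Tsym x5 x2) (Tsym x5 x3) (Tsym x5 x4).
have neq x y : (T x y).1 != 0 \/ (T x y).2 != 0 -> x != y.
  by move=> h; apply/eqP=> xy; move: h; rewrite xy Tdiag eqxx => -[].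
have adjacent a' b' c' : a' \in X -> b' \in X -> c' \in X ->
    (T a' b').1 != 0 -> (T a' b').2 = 0 -> (T a' c').1 = 0 -> (T a' c').2 != 0 ->
    False.
  move=> aX bX cX ab1 ab2 ac1 ac2.
  have ab : a' != b' by apply: neq; left.
  have ac : a' != c' by apply: neq; right.
  have bc : b' != c' by apply: contra_neq ac2 => <-.
  have [||s uniq_s sX] := @seq_completion [:: a'; b'; c'].
  - by rewrite /= !inE !negb_or ab ac bc.
  - by move=> z; rewrite !inE => /or3P[] /eqP->.
  have := completion_size uniq_s sX.
  case: s uniq_s sX => [|d' [|g [|]]] // uniq_s sX _.
  have [e1 e2 e3 e4 e5] := listed _ _ _ _ _ uniq_s sX.
  exact: (balanced_adjacent e1 e2 e3 e4 e5 ab1 ab2 ac1 ac2 (count5 uniq_s sX)).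
move=> aX bX cX dX ab1 ab2 cd1 cd2.
have ab : a != b by apply: neq; left.
have cd : c != d by apply: neq; right.
have [ac|ac] := eqVneq a c; first by subst c; apply: (@adjacent a b d).
have [bc|bc] := eqVneq b c.
  by subst c; apply: (@adjacent b a d); rewrite // Tsym.
have [ad|ad] := eqVneq a d.
  by subst d; apply: (@adjacent a b c); rewrite // Tsym.
have [bd|bd] := eqVneq b d.
  by subst d; apply: (@adjacent b a c); rewrite // Tsym.
have [||s uniq_s sX] := @seq_completion [:: a; b; c; d].
- by rewrite /= !inE !negb_or ab ac bc ad bd cd.
- by move=> z; rewrite !inE => /or4P[] /eqP->.
have := completion_size uniq_s sX; case: s uniq_s sX => [|g [|]] // uniq_s sX _.
have [e1 e2 e3 e4 e5] := listed _ _ _ _ _ uniq_s sX.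
exact: (balanced_disjoint e1 e2 e3 e4 e5 ab1 ab2 cd1 cd2 (count5 uniq_s sX)).
Qed.

Lemma few_edges_star a b c d : a \in X -> b \in X -> c \in X -> d \in X ->
  (T a b).1 != 0 -> (T a b).2 = 0 -> (T c d).1 = 0 -> (T c d).2 != 0 ->
  exists2 k, k \in X & {in X &, forall x y, x != k -> y != k -> T x y = 0}.
Proof.
move=> aX bX cX dX ab1 ab2 cd1 cd2.
have [/exists_inP[i iX /exists_inP[j jX rij]]|par] := boolP
  [exists i in X, exists j in X, bracket (r i) (r j) != 0].
  exact: (nondegenerate_star iX jX rij).
have {}par : {in X &, forall i j, bracket (r i) (r j) = 0}.
  move=> i j iX jX; apply/eqP; apply: contraNT par => rij.
  by apply/exists_inP; exists i => //; apply/exists_inP; exists j.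
exfalso; have [/exists_inP[i iX ri]|r0] := boolP [exists i in X, r i != 0]; last first.
  apply: (@balanced_few_edges a b c d) => // i iX; apply/eqP.
  by apply: contraNT r0 => ri; apply/exists_inP; exists i.
have anti u v : bracket u v = 0 -> bracket v u = 0 by rewrite /bracket; lra.
(* All row sums are parallel to [r i], and so is every [T i y] by [polar2]. Two terms of [polar]
   drop out, and every weight becomes parallel to [r i]. *)
have riT j k : j \in X -> k \in X -> bracket (r i) (T j k) = 0.
  move=> jX kX; have := polar iX jX kX.
  have rT x y : x \in X -> y \in X -> bracket (r x) (T i y) = 0.
    move=> xX yX; apply: (bracket_trans ri); first exact: par.
    exact/anti/polar2.
  by rewrite !rT // !addr0.
have : bracket (T a b) (T c d) = 0.
  by apply: (bracket_trans ri); apply: anti; apply: riT.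
rewrite /bracket ab2 mul0r subr0 => /eqP; rewrite mulf_eq0.
by rewrite (negPf ab1) (negPf cd2).
Qed.

End FivePoints.

(** * The cubic of a pair of strains *)

Section Forms.

Variables (R : realFieldType) (V : finType).
Implicit Types (S : V -> V -> R) (x y z : V -> R) (X : {set V}).

Definition edge_form S x y : R := \sum_i \sum_j x i * y j * S i j.

Definition supported X x := forall i, i \notin X -> x i = 0.

Lemma edge_form_comb S x y z s t :
  edge_form S x (fun i => s * y i + t * z i) = s * edge_form S x y + t * edge_form S x z.
Proof.
rewrite !mulr_sumr -big_split; apply: eq_bigr => i _ /=.
by rewrite !mulr_sumr -big_split; apply: eq_bigr => j _ /=; ring.
Qed.

Lemma edge_formC S x y : (forall i j, S i j = S j i) -> edge_form S x y = edge_form S y x.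
Proof.
move=> symS; rewrite /edge_form exchange_big; apply: eq_bigr => j _.
by apply: eq_bigr => i _; rewrite symS; ring.
Qed.

Lemma supported_comb X x y s t :
  supported X x -> supported X y -> supported X (fun i => s * x i + t * y i).
Proof. by move=> x0 y0 i iX; rewrite x0 // y0 // !mulr0 addr0. Qed.

Variables (S1 S2 : V -> V -> R) (l : V -> R).
Hypotheses (sym1 : forall i j, S1 i j = S1 j i).
Hypotheses (sym2 : forall i j, S2 i j = S2 j i).

(** The determinant of the two equations [l S x = 0] and [x S x = 0] in the coefficients of [S] on
    [S1] and [S2]. *)
Definition cubic x : R :=
  edge_form S1 l x * edge_form S2 x x - edge_form S2 l x * edge_form S1 x x.

Let form1C x y : edge_form S1 x y = edge_form S1 y x. Proof. exact: edge_formC. Qed.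
Let form2C x y : edge_form S2 x y = edge_form S2 y x. Proof. exact: edge_formC. Qed.

Lemma cubic_comb x y s t : cubic (fun i => s * x i + t * y i) =
  (s * edge_form S1 l x + t * edge_form S1 l y) *
    (s ^+ 2 * edge_form S2 x x + 2 * s * t * edge_form S2 x y + t ^+ 2 * edge_form S2 y y) -
  (s * edge_form S2 l x + t * edge_form S2 l y) *
    (s ^+ 2 * edge_form S1 x x + 2 * s * t * edge_form S1 x y + t ^+ 2 * edge_form S1 y y).
Proof.
rewrite /cubic !edge_form_comb !(form1C (fun i => s * x i + t * y i)).
rewrite !(form2C (fun i => s * x i + t * y i)) !edge_form_comb.
by rewrite (form1C y x) (form2C y x); ring.
Qed.

(* On the hyperplane of sum 0, [4 (g 1 + g (-1)) - (g 2 + g (-2))] is six times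
   the constant term of the cubic [g t = cubic (x + t delta_a)]. *)
Lemma cubic_homogeneous X a : a \in X ->
    (forall x, supported X x -> \sum_i x i = 1 -> cubic x = 0) ->
  forall x, supported X x -> cubic x = 0.
Proof.
move=> aX cubic1.
(* Off the hyperplane of sum 0, rescale to sum 1 and use homogeneity of degree 3. *)
have cubic_neq0 x : supported X x -> \sum_i x i != 0 -> cubic x = 0.
  move=> x0 sumx; pose c := (\sum_i x i)^-1.
  have := cubic1 _ (supported_comb c 0 x0 x0).
  rewrite big_split /= -!mulr_sumr mul0r addr0 mulVf // => /(_ erefl).
  rewrite cubic_comb !mul0r !addr0 => c3.
  have : c ^+ 3 * cubic x = 0 by rewrite -[RHS]c3 /cubic; ring.
  by move=> /eqP; rewrite mulf_eq0 expf_eq0 invr_eq0 (negPf sumx) => /eqP.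
move=> x x0; have [sumx|] := eqVneq (\sum_i x i) 0; last exact: cubic_neq0.
pose d i : R := (i == a)%:R.
have d0 : supported X d.
  by move=> i iX; rewrite /d; case: eqP iX => // ->; rewrite aX.
have sumd : \sum_i d i = 1.
  by rewrite (bigD1 a) //= /d eqxx big1 ?addr0 // => i /negPf ->.
have g t : t != 0 -> cubic (fun i => 1 * x i + t * d i) = 0.
  move=> t0; apply: cubic_neq0; first exact: supported_comb.
  by rewrite big_split /= -!mulr_sumr sumx sumd mulr0 mulr1 add0r.
have := g 1; have := g (-1); have := g 2; have := g (-2).
rewrite !cubic_comb !oppr_eq0 oner_eq0 pnatr_eq0.
move=> /(_ isT) e1 /(_ isT) e2 /(_ isT) e3 /(_ isT) e4.
rewrite /cubic; lra.
Qed.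

(** Inclusion-exclusion over the sums of [x], [y], [z] isolates twice the trilinear part. *)
Lemma cubic_polar X : (forall x, supported X x -> cubic x = 0) ->
  forall x y z, supported X x -> supported X y -> supported X z ->
    (edge_form S1 l x * edge_form S2 y z - edge_form S2 l x * edge_form S1 y z) +
    (edge_form S1 l y * edge_form S2 x z - edge_form S2 l y * edge_form S1 x z) +
    (edge_form S1 l z * edge_form S2 x y - edge_form S2 l z * edge_form S1 x y) = 0.
Proof.
move=> cubic0 x y z x0 y0 z0.
have sup u v (u0 : supported X u) (v0 : supported X v) :
  supported X (fun i => 1 * u i + 1 * v i) by apply: supported_comb.
have exyz := cubic0 _ (sup _ _ x0 (sup _ _ y0 z0)).
have exy := cubic0 _ (sup _ _ x0 y0); have exz := cubic0 _ (sup _ _ x0 z0).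
have eyz := cubic0 _ (sup _ _ y0 z0).
have [[ex ey] ez] := (cubic0 _ x0, cubic0 _ y0, cubic0 _ z0).
move: exyz exy exz eyz ex ey ez; rewrite !cubic_comb !edge_form_comb.
rewrite !(form1C (fun i => 1 * y i + 1 * z i)).
rewrite !(form2C (fun i => 1 * y i + 1 * z i)) !edge_form_comb.
rewrite /cubic (form1C z y) (form2C z y) => *; lra.
Qed.

End Forms.

(** * One-vertex extensions *)

Section Extension.

Variables (R : realType) (V : finType).
Implicit Types (E : {set {set V}}) (X : {set V}) (rho u : V -> 'cV[R]_3).

(** Five rows of homogeneous coordinates in dimension four are dependent. A zero coefficient would
    leave a dependence of four generic points. *)
Lemma affine_dependence X rho : generic rho -> #|X| = 5%N ->
  exists l : V -> R, [/\ supported X l, {in X, forall i, l i != 0},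
    \sum_i l i = 0 & \sum_i l i *: rho i = 0].
Proof.
move=> gen_rho cardX.
pose A : 'M[R]_(#|X|, 3 + 1) :=
  row_mx (\matrix_(k, c) rho (enum_val k) c 0) (const_mx 1).
have /rowV0Pn[v /sub_kermxP vA0 v0] : kermx A != 0.
  rewrite kermx_eq0 -row_leq_rank -ltnNge.
  by rewrite (leq_ltn_trans (rank_leq_col A)) // cardX.
pose l i := \sum_(k < #|X|) v 0 k * (enum_val k == i)%:R.
have suml (W : lmodType R) (F : V -> W) :
    \sum_i l i *: F i = \sum_k v 0 k *: F (enum_val k).
  rewrite (eq_bigr (fun i =>
    \sum_(k < #|X|) (v 0 k * (enum_val k == i)%:R) *: F i)); last first.
    by move=> i _; rewrite scaler_suml.
  rewrite exchange_big; apply: eq_bigr => k _ /=.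
  rewrite (bigD1 (enum_val k)) //= eqxx mulr1 big1 ?addr0 // => i.
  by rewrite eq_sym => /negPf ->; rewrite mulr0 scale0r.
have lX : supported X l.
  move=> i iX; rewrite /l big1 // => k _; case: eqP => [ki|]; last by rewrite mulr0.
  by rewrite -ki enum_valP in iX.
have l_enum k : l (enum_val k) = v 0 k.
  rewrite /l (bigD1 k) //= eqxx mulr1 big1 ?addr0 // => j jk.
  by rewrite (inj_eq enum_val_inj) (negPf jk) mulr0.
have suml0 : \sum_i l i = 0.
  have := suml R^o (fun=> 1); rewrite (eq_bigr l) => [->|i _]; last exact: mulr1.
  have /rowP/(_ (rshift 3 0)) := vA0; rewrite !mxE => vA; rewrite -[RHS]vA.
  by apply: eq_bigr => k _; rewrite row_mxEr mxE.
have sumlr : \sum_i l i *: rho i = 0.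
  rewrite suml; apply/colP=> c; have /rowP/(_ (lshift 1 c)) := vA0; rewrite !mxE.
  by move=> vA; rewrite -[RHS]vA summxE; apply: eq_bigr => k _; rewrite row_mxEl !mxE.
exists l; split=> // i iX; apply: contra_neq v0 => li0.
apply/rowP=> k; rewrite mxE -l_enum.
apply: (generic_affine_free (A := X :\ i) gen_rho) => //.
  by have := cardsD1 i X; rewrite iX cardX add1n => -[<-].
move=> j; rewrite !inE negb_and negbK => /orP[/eqP->//|]; exact: lX.
Qed.

(* The conditions on [w] say that the motion extends to a new vertex placed at
   [p] and joined to [X]; [x] and [y] are dependencies of those new edges. *)
Lemma extension_form X rho u (p w : 'cV[R]_3) (x y : V -> R) :
  supported X x -> supported X y ->
  \sum_i x i *: (rho i - p) = 0 -> \sum_i y i *: (rho i - p) = 0 ->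
  {in X, forall i, (u i - w)^T *m (rho i - p) = 0} ->
  edge_form (strain rho u) x y = 0.
Proof.
move=> x0 y0 xp yp flex.
pose v i := u i - w; pose d i := rho i - p.
pose m i j : R := ((v i)^T *m d j) 0 0.
(* On [X] the diagonal terms of [m] vanish. Of the other two, one is killed by summing against [y],
   the other by summing against [x]. *)
have strain_m i j : strain rho u i j = m i i + m j j - m i j - m j i.
  rewrite strainE /m !mxE -big_split -!sumrB; apply: eq_bigr => c _ /=.
  by rewrite !mxE; ring.
have m0 i : i \in X -> m i i = 0 by move=> iX; rewrite /m flex // mxE.
have summ (z : V -> R) i : \sum_j z j *: d j = 0 -> \sum_j z j * m i j = 0.
  move=> zd; transitivity (((v i)^T *m \sum_j z j *: d j) 0 0); last first.
    by rewrite zd mulmx0 mxE.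
  rewrite mulmx_sumr summxE; apply: eq_bigr => j _.
  by rewrite -scalemxAr [RHS]mxE.
rewrite /edge_form (eq_bigr (fun i => - (x i * \sum_j y j * m i j)
  - \sum_j y j * (x i * m j i))).
  rewrite sumrB sumrN big1 => [|i _]; last by rewrite summ ?mulr0.
  rewrite exchange_big oppr0 sub0r big1 ?oppr0 // => j _ /=.
  by rewrite -mulr_sumr summ ?mulr0.
move=> i _; rewrite mulr_sumr -sumrN -sumrB; apply: eq_bigr => j _; rewrite strain_m.
case: (boolP (i \in X)) => [/m0 ->|/x0 ->]; last by ring.
by case: (boolP (j \in X)) => [/m0 ->|/y0 ->]; ring.
Qed.

Lemma mem_add_vertex_Some E X i j :
  [set i; j] \in E -> [set Some i; Some j] \in add_vertex E X.
Proof.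
move=> ijE; rewrite inE; apply/orP; left; apply/imsetP; exists [set i; j] => //.
by rewrite imsetU1 imset_set1.
Qed.

Lemma mem_add_vertex_None E X i :
  i \in X -> [set Some i; None] \in add_vertex E X.
Proof.
by move=> iX; rewrite inE setUC; apply/orP; right; apply/imsetP; exists i.
Qed.

(** The difference is written as a combination so that [strain_comb] rewrites its strains. *)
Definition spans_flexes E rho (u1 u2 : V -> 'cV[R]_3) :=
  forall u, inf_flex E rho u -> exists a b : R,
    trivial_flex rho (fun k => 1 *: u k + (-1) *: (a *: u1 k + b *: u2 k)).

(** By [extension_form], the coefficients [a], [b] of a flex satisfy two linear equations whose
    determinant is the cubic, so both vanish. The motion of the old points is then trivial, and the
    edges to [X] fix the velocity of the new one. *)
Lemma inf_rigid_add_vertex E X rho u1 u2 (l m : V -> R) :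
  generic rho -> #|X| = 5%N -> spans_flexes E rho u1 u2 ->
  supported X l -> \sum_i l i = 0 -> \sum_i l i *: rho i = 0 ->
  supported X m -> \sum_i m i = 1 ->
  cubic (strain rho u1) (strain rho u2) l m != 0 ->
  inf_rigid (add_vertex E X)
    (fun o => if o is Some i then rho i else \sum_i m i *: rho i).
Proof.
move=> gen_rho cardX span l0 suml sumlr m0 summ cubic0 u' flex'.
set p := \sum_i m i *: rho i.
pose u i := u' (Some i); pose w := u' None.
have flex_new : {in X, forall i, (u i - w)^T *m (rho i - p) = 0}.
  by move=> i iX; apply: (flex' (Some i) None); apply: mem_add_vertex_None.
have [|a [b triv]] := span u.
  by move=> i j ijE; apply: (flex' (Some i) (Some j)); apply: mem_add_vertex_Some.
have strain_u i j : strain rho u i j =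
    a * strain rho u1 i j + b * strain rho u2 i j.
  have := strain_trivial i j triv; rewrite !strain_comb; lra.
have form_u x y : edge_form (strain rho u) x y =
    a * edge_form (strain rho u1) x y + b * edge_form (strain rho u2) x y.
  rewrite /edge_form !mulr_sumr -big_split; apply: eq_bigr => i _ /=.
  rewrite !mulr_sumr -big_split; apply: eq_bigr => j _ /=.
  by rewrite strain_u; ring.
have dep (z : V -> R) : \sum_i z i *: (rho i - p) =
    \sum_i z i *: rho i - (\sum_i z i) *: p.
  by rewrite scaler_suml -sumrB; apply: eq_bigr => i _; rewrite scalerBr.
have depl : \sum_i l i *: (rho i - p) = 0 by rewrite dep suml sumlr scale0r subrr.
have depm : \sum_i m i *: (rho i - p) = 0 by rewrite dep summ scale1r subrr.
have := extension_form l0 m0 depl depm flex_new.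
have := extension_form m0 m0 depm depm flex_new; rewrite !form_u => eq1 eq2.
(* Cramer's rule: [b] is eliminated from the two equations. *)
have a0 : a = 0.
  apply/eqP; have : a * cubic (strain rho u1) (strain rho u2) l m = 0.
    transitivity ((a * edge_form (strain rho u1) l m + b * edge_form (strain rho u2) l m) *
        edge_form (strain rho u2) m m - edge_form (strain rho u2) l m *
        (a * edge_form (strain rho u1) m m + b * edge_form (strain rho u2) m m)).
      by rewrite /cubic; ring.
    by rewrite eq1 eq2 mul0r mulr0 subrr.
  by move=> /eqP; rewrite mulf_eq0 (negPf cubic0) orbF.
have b0 : b = 0.
  apply/eqP; have : b * cubic (strain rho u1) (strain rho u2) l m = 0.
    transitivity (edge_form (strain rho u1) l m *
        (a * edge_form (strain rho u1) m m + b * edge_form (strain rho u2) m m) -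
        (a * edge_form (strain rho u1) l m + b * edge_form (strain rho u2) l m) *
        edge_form (strain rho u1) m m).
      by rewrite /cubic; ring.
    by rewrite eq1 eq2 mul0r mulr0 subrr.
  by move=> /eqP; rewrite mulf_eq0 (negPf cubic0) orbF.
case: triv => s [t [skew_s uE]].
have {}uE i : u i = t + s *m rho i.
  by rewrite -uE a0 b0 !scale0r addr0 scaler0 addr0 scale1r.
exists s, t; split=> // -[i|]; first exact: uE.
(* The deviation of the new vertex from the rigid motion is orthogonal to all [rho i - p] with [i]
   in [X]; four of these points force it to be zero. *)
pose z := w - (t + s *m p).
suff z0 : z = 0 by apply/eqP; rewrite -subr_eq0 -/w -/z z0.
have /card_gt0P[k kX] : (0 < #|X|)%N by rewrite cardX.
apply: (@generic_affine_span _ _ (X :\ k) rho z ((z^T *m p) 0 0) gen_rho).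
  by have := cardsD1 k X; rewrite kX cardX add1n => -[<-].
move=> i; rewrite !inE => /andP[_ iX]; have := flex_new i iX.
have -> : u i - w = s *m (rho i - p) - z.
  by rewrite uE /z mulmxBr opprB; apply/colP=> c; rewrite !mxE; ring.
rewrite [(_ - z)^T]linearB /= mulmxBl skew_dot // sub0r => /eqP; rewrite oppr_eq0 mulmxBr.
by rewrite subr_eq0 => /eqP ->.
Qed.

End Extension.

(** * Counting ordered pairs of points of [X] *)

Lemma double_card_le_ordered_pairs (V : finType) (F : {set {set V}}) (X : {set V}) :
  (forall Y, Y \in F -> Y \subset X /\ #|Y| = 2%N) ->
  (2 * #|F| <= \sum_(i in X) \sum_(j in X) ([set i; j] \in F))%N.
Proof.
move=> FX.
have memF (Y : {set V}) : (Y \in F : nat) = (\sum_(Z in F) (Y == Z))%N.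
  case: (boolP (Y \in F)) => YF.
    rewrite (bigD1 Y) //= eqxx big1 ?addn0 // => Z /andP[_].
    by rewrite eq_sym => /negPf ->.
  by rewrite big1 // => Z; case: eqP => // <-; rewrite (negPf YF).
have -> : (\sum_(i in X) \sum_(j in X) ([set i; j] \in F) =
           \sum_(Y in F) \sum_(i in X) \sum_(j in X) ([set i; j] == Y))%N.
  rewrite [RHS]exchange_big; apply: eq_bigr => i _ /=.
  by rewrite [RHS]exchange_big; apply: eq_bigr => j _; apply: memF.
rewrite mulnC -sum_nat_const.
apply: leq_sum => Y /FX[YX /eqP/cards2P[i [j [ij eY]]]]; subst Y.
have [iX jX] : i \in X /\ j \in X.
  by split; apply: (subsetP YX); rewrite !inE eqxx ?orbT.
pose f x := (\sum_(y in X) ([set x; y] == [set i; j]))%N.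
have fi : (1 <= f i)%N by rewrite /f (bigD1 j) //= eqxx.
have fj : (1 <= f j)%N by rewrite /f (bigD1 i) //= setUC eqxx.
have ji : (j \in X) && (j != i) by rewrite jX eq_sym.
rewrite (bigD1 i) //= (bigD1 j ji) /=.
exact: (leq_add fi (leq_trans fj (leq_addr _ _))).
Qed.

(** Of the 25 ordered pairs, 5 are diagonal and at least 10 come from [F]. *)
Lemma few_ordered_nonedges (V : finType) (F : {set {set V}}) (X : {set V})
    (P : V -> V -> bool) : #|X| = 5%N -> (5 <= #|F|)%N ->
  (forall Y, Y \in F -> Y \subset X /\ #|Y| = 2%N) ->
  (forall i, ~~ P i i) -> (forall i j, [set i; j] \in F -> ~~ P i j) ->
  (\sum_(i in X) \sum_(j in X) P i j <= 10)%N.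
Proof.
move=> cardX cardF FX Pdiag PF.
have total : (\sum_(i in X) \sum_(j in X) 1 = 25)%N.
  by rewrite !sum_nat_const cardX.
have diag : (\sum_(i in X) \sum_(j in X) (i == j) = 5)%N.
  rewrite -cardX -sum1_card; apply: eq_bigr => i iX.
  rewrite (bigD1 i) //= eqxx big1 ?addn0 // => j /andP[_].
  by rewrite eq_sym => /negPf ->.
have split_total : (\sum_(i in X) \sum_(j in X) P i j +
    \sum_(i in X) \sum_(j in X) (i == j) +
    \sum_(i in X) \sum_(j in X) ([set i; j] \in F) <= 25)%N.
  rewrite -total -!big_split leq_sum //= => i iX; rewrite -!big_split leq_sum //=.
  move=> j jX; have [->|ij] := eqVneq i j; last first.
    by case: (boolP (_ \in F)) => [/PF/negPf -> //|_]; case: (P i j).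
  rewrite (negPf (Pdiag j)); case: (boolP (_ \in F)) => // /FX[_].
  by rewrite setUid cards1.
have := double_card_le_ordered_pairs FX; move: split_total cardF; rewrite diag.
by clear; lia.
Qed.

(** * Flexes released by deleting edges of an isostatic framework *)

Section Isostatic.

Variables (R : realType) (V : finType) (E : {set {set V}}) (rho : V -> 'cV[R]_3).
Hypothesis isoE : isostatic E rho.

(** A nontrivial flex appears when the edge is deleted; with zero strain on that edge it would be a
    flex of [E], hence trivial. *)
Lemma isostatic_flex a b : [set a; b] \in E ->
  exists2 u, inf_flex (E :\ [set a; b]) rho u & strain rho u a b != 0.
Proof.
case: isoE => rigidE minE abE; have := minE _ abE.
move=> /existsNP[u /not_implyP[flex_u nontriv]]; exists u => //.
apply/eqP => strain0; apply/nontriv/rigidE/inf_flexP => i j ijE.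
have [ij_ab|ij_ab] := eqVneq [set i; j] [set a; b]; last first.
  by apply/strain_eq0/flex_u; rewrite !inE ij_ab.
have : i \in [set a; b] by rewrite -ij_ab !inE eqxx.
have : j \in [set a; b] by rewrite -ij_ab !inE eqxx orbT.
rewrite !inE => /orP[] /eqP -> /orP[] /eqP -> //; rewrite ?strainxx //.
by rewrite strainC.
Qed.

(** Subtracting multiples of [u1] and [u2] clears the strains on the two deleted edges. What remains
    is a flex of [E], hence trivial. *)
Lemma isostatic_spans a b c d (u1 u2 : V -> 'cV[R]_3) :
  strain rho u1 a b != 0 -> strain rho u1 c d = 0 ->
  strain rho u2 a b = 0 -> strain rho u2 c d != 0 ->
  inf_flex (E :\: [set [set a; b]; [set c; d]]) rho u1 ->
  inf_flex (E :\: [set [set a; b]; [set c; d]]) rho u2 ->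
  spans_flexes (E :\: [set [set a; b]; [set c; d]]) rho u1 u2.
Proof.
move=> ab1 cd1 ab2 cd2 /inf_flexP flex1 /inf_flexP flex2 u /inf_flexP flex.
exists (strain rho u a b / strain rho u1 a b), (strain rho u c d / strain rho u2 c d).
apply: isoE.1; apply/inf_flexP => i j ijE; rewrite !strain_comb.
have pair_strain x y : [set i; j] = [set x; y] -> forall v,
    strain rho v i j = strain rho v x y.
  move=> ij_xy v.
  have : i \in [set x; y] by rewrite -ij_xy !inE eqxx.
  have : j \in [set x; y] by rewrite -ij_xy !inE eqxx orbT.
  have : x \in [set i; j] by rewrite ij_xy !inE eqxx.
  have : y \in [set i; j] by rewrite ij_xy !inE eqxx orbT.
  rewrite !inE => yij xij /orP[] /eqP ej /orP[] /eqP ei //; subst i j => //.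
  - by move: yij; rewrite orbb => /eqP ->.
  - by rewrite strainC.
  - by move: xij; rewrite orbb => /eqP ->.
have [ij|ab] := eqVneq [set i; j] [set a; b].
  by rewrite !(pair_strain _ _ ij) ab2 divfK // mulr0 addr0 mul1r mulN1r subrr.
have [ij|cd] := eqVneq [set i; j] [set c; d].
  by rewrite !(pair_strain _ _ ij) cd1 divfK // mulr0 add0r mul1r mulN1r subrr.
have ijF : [set i; j] \in E :\: [set [set a; b]; [set c; d]].
  by rewrite !inE negb_or ab cd.
by rewrite (flex i j ijF) (flex1 i j ijF) (flex2 i j ijF) !mulr0 addr0 mulr0 addr0.
Qed.

End Isostatic.

Theorem theorem22 (R : realType) (V : finType) (E : {set {set V}})
    (hE : simple_graph E) (hiso : generically_isostatic R E)
    (X : {set V}) (hX : #|X| = 5%N) (e f : {set V})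
    (he : e \in induced_edges E X) (hf : f \in induced_edges E X)
    (hef : e != f) (hEX : (7 <= #|induced_edges E X|)%N) :
  (exists K : {set V},
     K \subset X /\ implied_K4 R (E :\: [set e; f]) K) \/
  generically_rigid R (add_vertex (E :\: [set e; f]) X).
Proof.
have [|nonrigid] := EM (generically_rigid R (add_vertex (E :\: [set e; f]) X)).
  by right.
(* One generic configuration at which rigidity fails is enough: the argument takes place at its
   restriction to [V]. *)
left; move: nonrigid => /existsNP[rho' /not_implyP[gen_rho' nonrigid]].
pose rho := rho' \o Some.
have gen_rho : generic rho := generic_comp_Some gen_rho'.
have iso := hiso rho gen_rho.
have edgeP g : g \in induced_edges E X ->
    exists a b, [/\ a \in X, b \in X, [set a; b] \in E & g = [set a; b]].
  rewrite inE => /andP[gE gX].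
  have /eqP/cards2P[a [b [_ eg]]] := hE g gE.
  have [aX bX] : a \in X /\ b \in X.
    by split; apply: (subsetP gX); rewrite eg !inE eqxx ?orbT.
  by exists a, b; split; rewrite // -eg.
have [a [b [aX bX abE ee]]] := edgeP e he.
have [c [d [cX dX cdE ef]]] := edgeP f hf.
have [u1 flex1 ab1] := isostatic_flex iso abE.
have [u2 flex2 cd2] := isostatic_flex iso cdE.
subst e f.
set F := E :\: _ in nonrigid *.
have cd1 : strain rho u1 c d = 0.
  by apply/strain_eq0/flex1; rewrite !inE cdE eq_sym hef.
have ab2 : strain rho u2 a b = 0.
  by apply/strain_eq0/flex2; rewrite !inE abE hef.
have flexF1 : inf_flex F rho u1.
  by move=> i j; rewrite !inE negb_or => /andP[/andP[ab _] ijE]; apply: flex1;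
    rewrite !inE ab.
have flexF2 : inf_flex F rho u2.
  by move=> i j; rewrite !inE negb_or => /andP[/andP[_ cd] ijE]; apply: flex2;
    rewrite !inE cd.
have span : spans_flexes F rho u1 u2 by exact: (isostatic_spans iso).
have [l [lX l_neq0 suml sumlr]] := affine_dependence gen_rho hX.
pose S1 := strain rho u1; pose S2 := strain rho u2.
have sym1 i j : S1 i j = S1 j i by apply: strainC.
have sym2 i j : S2 i j = S2 j i by apply: strainC.
(* Otherwise the new vertex at the point with barycentric weights [m] gives a rigid framework, and
   rigidity passes to [rho']. *)
have cubic0 m : supported X m -> cubic S1 S2 l m = 0.
  apply: (cubic_homogeneous sym1 sym2 aX) => {}m mX summ.
  have [//|cubic_neq0] := eqVneq (cubic S1 S2 l m) 0.
  case: nonrigid; apply: (inf_rigid_generic gen_rho').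
  exact: (inf_rigid_add_vertex gen_rho hX span lX suml sumlr mX summ cubic_neq0).
pose T i j : R * R := (l i * l j * S1 i j, l i * l j * S2 i j).
have Tsym i j : T i j = T j i by rewrite /T sym1 sym2 [l i * l j]mulrC.
have Tdiag i : T i i = 0 by rewrite /T /S1 /S2 !strainxx mulr0.
have Toff i j : j \notin X -> T i j = 0 by move=> /lX lj; rewrite /T lj !(mulr0, mul0r).
(* At these vectors the edge forms return the entries of [T], and pairing with [l] returns its row
   sums. *)
pose dl i k : R := (k == i)%:R * l i.
have dlX i : i \in X -> supported X (dl i).
  by move=> iX k kX; rewrite /dl; case: eqP kX => [->|]; rewrite ?iX // mul0r.
have formE S i x : edge_form S (dl i) x = \sum_j l i * x j * S i j.
  rewrite /edge_form (bigD1 i) //= [X in _ + X]big1 ?addr0 => [|k /negPf ki]; last first.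
    by rewrite big1 // => j _; rewrite /dl ki !mul0r.
  by apply: eq_bigr => j _; rewrite /dl eqxx mul1r.
have form_dl S i j : edge_form S (dl i) (dl j) = l i * l j * S i j.
  rewrite formE (bigD1 j) //= big1 ?addr0 => [|k /negPf kj].
    by rewrite /dl eqxx mul1r.
  by rewrite /dl kj mul0r mulr0 mul0r.
have row1 i : (\sum_j T i j).1 = edge_form S1 l (dl i).
  by rewrite raddf_sum edge_formC // formE.
have row2 i : (\sum_j T i j).2 = edge_form S2 l (dl i).
  by rewrite raddf_sum edge_formC // formE.
have polar : {in X & &, forall i j k, bracket (\sum_x T i x) (T j k) +
    bracket (\sum_x T j x) (T i k) + bracket (\sum_x T k x) (T i j) = 0}.
  move=> i j k iX jX kX; rewrite /bracket !row1 !row2 /= -!form_dl.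
  exact: (cubic_polar sym1 sym2 cubic0 (dlX i iX) (dlX j jX) (dlX k kX)).
have few : (\sum_(i in X) \sum_(j in X) (T i j != 0%R) <= 10)%N.
  apply: (@few_ordered_nonedges _ (induced_edges E X :\: [set [set a; b]; [set c; d]])).
  - exact: hX.
  - have le2 := subset_leq_card
      (subsetIr (induced_edges E X) [set [set a; b]; [set c; d]]).
    by rewrite cards2 hef in le2; rewrite cardsD; apply: leq_sub hEX le2.
  - by move=> Y; rewrite !inE => /andP[_ /andP[YE YX]]; split=> //; apply: hE.
  - by move=> i; rewrite Tdiag eqxx.
  move=> i j; rewrite !inE negbK => /andP[ab_cd /andP[ijE _]].
  have ijF : [set i; j] \in F by rewrite !inE ab_cd.
  have s1 : S1 i j = 0 by apply/strain_eq0/flexF1.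
  have s2 : S2 i j = 0 by apply/strain_eq0/flexF2.
  by rewrite /T s1 s2 !mulr0.
have scaled_neq0 (x y : V) s : x \in X -> y \in X -> s != 0 -> l x * l y * s != 0.
  by move=> xX yX s0; rewrite !mulf_neq0 // l_neq0.
have [||||k kX star] :=
  few_edges_star hX Tsym Tdiag Toff polar few aX bX cX dX.
- exact: scaled_neq0.
- by rewrite /= /S2 ab2 mulr0.
- by rewrite /= /S1 cd1 mulr0.
- exact: scaled_neq0.
(* The four leaves, with the centre [k] of the star removed. *)
exists (X :\ k); split; first exact: subD1set.
split; first by have := cardsD1 k X; rewrite kX hX add1n => -[<-].
move=> i j; rewrite !inE => /andP[ik iX] /andP[jk jX] _.
apply: (implied_edge_generic gen_rho) => u /span[al [be triv]].
have [/eqP t1 /eqP t2] : (T i j).1 = 0 /\ (T i j).2 = 0 by rewrite star.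
(* All [l i] with [i] in [X] are nonzero, so a zero weight means zero strain for both flexes, and
   thus for every flex. *)
have s1 : strain rho u1 i j = 0.
  by apply: contraTeq t1 => /(scaled_neq0 _ _ _ iX jX).
have s2 : strain rho u2 i j = 0.
  by apply: contraTeq t2 => /(scaled_neq0 _ _ _ iX jX).
have := strain_trivial i j triv; rewrite !strain_comb s1 s2.
by rewrite !mulr0 addr0 mulr0 addr0 mul1r.
Qed.
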